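(* Let $n\ge 1$, let $a_{0},a_{1},\dots,a_{n}\in\mathbb{Z}$ with $a_n\neq 0$, and let $(L_k)_{k\geq 0}$ denote the sequence of Lucas numbers. If $$\left|\sum_{i=0}^{n}(-1)^{i}a_{i}^{2}+\sum_{0\leq i<j\leq n}(-1)^{i}L_{j-i}a_{i}a_{j}\right|=p\cdot q,$$ where $p$ is a prime number and $q$ is a positive integer, and $$|a_{0}|>\sum_{i=1}^{n}|a_{i}|\left(\frac{1+\sqrt{4q+5}}{2}\right)^{i},$$ then the polynomial $\sum_{i=0}^{n}a_{i}X^{i}$ is irreducible over $\mathbb{Q}$.
   Context: The Lucas numbers are defined by $L_0=2$, $L_1=1$ and $L_{k+2}=L_{k+1}+L_k$ for $k\ge 0$. *)

(* Defs.v *)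
From mathcomp Require Import all_boot.

Set Implicit Arguments.
Unset Strict Implicit.
Unset Printing Implicit Defensive.

Fixpoint lucas (n : nat) : nat :=
  match n with
  | 0 => 2
  | 1 => 1
  | (k.+1 as k1).+1 => lucas k1 + lucas k
  end.

Lemma lucasE :
  [/\ lucas 0 = 2, lucas 1 = 1
    & forall k, lucas k.+2 = lucas k.+1 + lucas k].
Proof. by []. Qed.

(* Main.v *)
Require Import Defs.
From mathcomp Require Import all_boot all_order all_algebra.
From mathcomp Require Import reals.
From mathcomp Require Import algC ring complex.

Set Implicit Arguments.
Unset Strict Implicit.
Unset Printing Implicit Defensive.

Import Order.TTheory GRing.Theory Num.Theory.
Local Open Scope ring_scope.

(** The quadratic expression in the coefficients of [f] is the norm
    [f(phi) f(psi)] of [f(phi)], where [phi] and [psi] are the roots of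
    [X^2 - X - 1]: since [phi psi = -1] and [phi^k + psi^k = L_k], the
    coefficient of [a_i a_j] in that product, for [i < j], is
    [(phi psi)^i (phi^(j-i) + psi^(j-i)) = (-1)^i L_(j-i)]
    ([golden_normE]). Hence this norm is an integer, and it is multiplicative
    in [f] ([golden_normM]).

    Factoring [g = b prod_k (X - theta_k)] over the complex numbers gives
    [g(phi) g(psi) = b^2 prod_k (theta_k^2 - theta_k - 1)]. With
    [r = (1 + sqrt(4q + 5)) / 2], the positive root of [r^2 - r - 1 = q],
    dominance of [a_0] forces every complex root of [f] outside the closed disc
    of radius [r] ([root_norm_gt]), and there [|theta^2 - theta - 1| > q]
    ([golden_quadratic_gt]). So every nonconstant integer divisor of [f] has
    norm greater than [q] in absolute value ([golden_norm_gt]).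

    By Gauss's lemma a proper factorization of [f] over the rationals yields one
    over the integers; the two factors have norms whose product is [p q] up to
    sign. The prime [p] divides one of them, so the other is at most [q] in
    absolute value, a contradiction. *)

(** * The norm form attached to the golden ratio *)

Definition golden_norm (g : {poly int}) : int :=
  \sum_(0 <= i < size g) (-1) ^+ i * g`_i ^+ 2
  + \sum_(0 <= i < size g) \sum_(i.+1 <= j < size g)
      (-1) ^+ i * (lucas (j - i))%:Z * g`_i * g`_j.

Section GoldenPair.

(** The hypotheses say that [X^2 - X - 1 = (X - u) (X - v)]. The ring is left
    arbitrary because the identities serve twice: over the algebraic numbers for
    multiplicativity, and over the field in which the roots are located. *)
Variables (A : comNzRingType) (u v : A).
Hypotheses (uDv : u + v = 1) (uMv : u * v = -1).

Lemma lucas_golden k : (lucas k)%:R = u ^+ k + v ^+ k.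
Proof.
suff: (lucas k)%:R = u ^+ k + v ^+ k /\ (lucas k.+1)%:R = u ^+ k.+1 + v ^+ k.+1.
  by case.
elim: k => [|k [IH0 IH1]]; first by rewrite !expr0 !expr1 uDv.
split=> //; have [_ _ ->] := lucasE; rewrite natrD IH0 IH1.
rewrite -[u ^+ k.+1 + _]mulr1 -uDv.
rewrite !exprS; ring: uMv.
Qed.

Lemma triangular_sum_recr (F : nat -> nat -> A) m :
  \sum_(0 <= i < m.+1) \sum_(i.+1 <= j < m.+1) F i j =
  \sum_(0 <= i < m) \sum_(i.+1 <= j < m) F i j + \sum_(0 <= i < m) F i m.
Proof.
rewrite big_nat_recr //= [X in _ + X]big_geq // addr0 -big_split /=.
by apply: eq_big_nat => i /andP[_ lt_im]; rewrite big_nat_recr.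
Qed.

Lemma mulr_sum_triangular (x y : nat -> A) m :
  (\sum_(0 <= i < m) x i) * (\sum_(0 <= j < m) y j) =
  \sum_(0 <= i < m) x i * y i
  + \sum_(0 <= i < m) \sum_(i.+1 <= j < m) (x i * y j + x j * y i).
Proof.
elim: m => [|m IH]; first by rewrite !big_geq // mul0r addr0.
rewrite triangular_sum_recr big_split /= -mulr_suml -mulr_sumr.
rewrite ![\sum_(0 <= i < m.+1) _]big_nat_recr //= mulrDl !mulrDr IH.
ring.
Qed.

(** In the product of the two evaluations, the terms [(i, j)] and [(j, i)] with
    [i < j] share the factor [(u v)^i], and [u^(j-i) + v^(j-i)] is a Lucas
    number. *)
Lemma golden_normE (g : {poly int}) :
  (golden_norm g)%:~R = (map_poly intr g).[u] * (map_poly intr g).[v].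
Proof.
have hornerE z : (map_poly intr g).[z] =
    \sum_(0 <= i < size g) (g`_i)%:~R * z ^+ i.
  rewrite (@horner_coef_wide _ (size g)) ?size_poly // big_mkord.
  by apply: eq_bigr => i _; rewrite coef_map.
rewrite !hornerE mulr_sum_triangular rmorphD !rmorph_sum; congr (_ + _).
  apply: eq_bigr => i _; rewrite rmorphM rmorphXn rmorphN1 rmorphXn -uMv exprMn.
  by ring.
apply: eq_big_nat => i _; rewrite rmorph_sum; apply: eq_big_nat => j /andP[lt_ij _].
rewrite !rmorphM rmorphXn rmorphN1 -uMv exprMn /= -pmulrn lucas_golden.
have exprjE (w : A) : w ^+ j = w ^+ i * w ^+ (j - i).
  by rewrite -exprD subnKC // ltnW.
by rewrite !exprjE; ring.
Qed.

End GoldenPair.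

Lemma golden_pair_exists (C : numClosedFieldType) :
  exists u v : C, u + v = 1 /\ u * v = -1.
Proof.
exists ((1 + sqrtC 5) / 2), ((1 - sqrtC 5) / 2).
split; first by field.
have -> : (1 + sqrtC 5) / 2 * ((1 - sqrtC 5) / 2) = (1 - sqrtC 5 ^+ 2) / 4 :> C.
  by field.
by rewrite sqrtCK; field.
Qed.

(** Evaluation at a root of [X^2 - X - 1] is multiplicative, and integers embed
    into a field containing these roots. *)
Lemma golden_normM : {morph golden_norm : g h / g * h}.
Proof.
move=> g h; have [u [v [uDv uMv]]] := golden_pair_exists algC.
apply: (@intr_inj algC).
by rewrite intrM !(golden_normE uDv uMv) rmorphM !hornerM mulrACA.
Qed.

(** * Location of roots and size of the norm *)

(** At a root of norm at most [r], the constant term would be the opposite of a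
    sum too small to cancel it. *)
Lemma root_norm_gt (C : numFieldType) n (a : nat -> C) r z :
  0 <= r ->
  \sum_(1 <= i < n.+1) `|a i| * r ^+ i < `|a 0%N| ->
  \sum_(0 <= i < n.+1) a i * z ^+ i = 0 ->
  r < `|z|.
Proof.
move=> r_ge0 a0_gt; rewrite big_ltn // expr0 mulr1 => /eqP.
rewrite addr_eq0 => /eqP a0E.
rewrite real_ltNge ?ger0_real //; apply/negP => le_zr.
suff: `|a 0%N| < `|a 0%N| by rewrite ltxx.
apply: le_lt_trans a0_gt; rewrite {1}a0E normrN.
apply: le_trans (ler_norm_sum _ _ _) _; apply: ler_sum => i _.
by rewrite normrM normrX ler_wpM2l // lerXn2r ?nnegrE.
Qed.

(** The reverse triangle inequality bounds [`|z ^+ 2 - z - 1|] from below by the value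
    at [`|z|] of [t^2 - t - 1], which increases for [t >= 1]. *)
Lemma golden_quadratic_gt (C : numFieldType) (r s z : C) :
  1 <= r -> r ^+ 2 - r - 1 = s -> r < `|z| -> s < `|z ^+ 2 - z - 1|.
Proof.
move=> r_ge1 <- lt_rz.
have z_ge1 : 1 <= `|z| := le_trans r_ge1 (ltW lt_rz).
apply: (@lt_le_trans _ _ (`|z| ^+ 2 - `|z| - 1)).
  rewrite ltrD2r -subr_gt0.
  have -> : `|z| ^+ 2 - `|z| - (r ^+ 2 - r) = (`|z| - r) * (`|z| + (r - 1)).
    by ring.
  rewrite mulr_gt0 ?subr_gt0 // ltr_wpDr ?subr_ge0 //.
  exact: lt_le_trans z_ge1.
rewrite -!addrA -!opprD -normrX.
apply: le_trans (lerB_dist _ _).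
by rewrite lerD2l lerN2 (le_trans (ler_normD _ _)) // normr1.
Qed.

Lemma norm_prod_gt (C : numDomainType) (I : eqType) (s : seq I) (F : I -> C) c :
  1 <= c -> (0 < size s)%N -> {in s, forall i, c < `|F i|} ->
  c < \prod_(i <- s) `|F i|.
Proof.
move=> c_ge1; case: s => // i s _ F_gt; rewrite big_cons.
apply: lt_le_trans (F_gt i (mem_head _ _)) _.
rewrite ler_peMr // big_seq_cond.
elim/big_ind: _ => [|x y x_ge1 y_ge1|j]; rewrite ?mulr_ege1 //.
rewrite andbT => s_j; apply: ltW; apply: le_lt_trans c_ge1 _.
by apply: F_gt; rewrite inE s_j orbT.
Qed.

(** The norm is [b^2] times the product of the [z^2 - z - 1] over the roots [z]
    of [g], where [b] is the leading coefficient. Since [b] is a nonzero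
    integer, a single root already makes the norm exceed [q]. *)
Lemma golden_norm_gt (C : numClosedFieldType) (r : C) q (g : {poly int}) :
  1 <= r -> r ^+ 2 - r - 1 = q%:R -> (0 < q)%N -> (1 < size g)%N ->
  (forall z : C, root (map_poly intr g) z -> r < `|z|) ->
  (q < `|golden_norm g|)%N.
Proof.
move=> r_ge1 rE q_gt0 size_g root_gt.
have [u [v [uDv uMv]]] := golden_pair_exists C.
have size_gC : size (map_poly intr g : {poly C}) = size g.
  by apply: size_map_inj_poly => //; apply: intr_inj.
have [s gE] := closed_field_poly_normal (map_poly intr g : {poly C}).
set b := lead_coef _ in gE.
have b_neq0 : b != 0.
  by rewrite lead_coef_eq0 -size_poly_gt0 size_gC (ltn_trans _ size_g).
have b_ge1 : 1 <= `|b|.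
  have bE : b = (lead_coef g)%:~R by rewrite /b lead_coef_map_inj //; apply: intr_inj.
  by move: b_neq0; rewrite bE intr_eq0 -intr_norm ler1z -gtz0_ge1 normr_gt0.
have size_s : (0 < size s)%N.
  by move: size_g; rewrite -size_gC gE size_scale // size_prod_XsubC ltnS.
have root_s : {in s, forall z, q%:R < `|z ^+ 2 - z - 1|}.
  move=> z s_z; apply: golden_quadratic_gt r_ge1 rE (root_gt z _).
  by rewrite gE rootZ // root_prod_XsubC.
have normE : `|(golden_norm g)%:~R : C| =
    `|b| ^+ 2 * \prod_(z <- s) `|z ^+ 2 - z - 1|.
  rewrite (golden_normE uDv uMv) gE !hornerZ !horner_prod.
  rewrite mulrACA -expr2 -big_split /= normrM normrX normr_prod; congr (_ * _).
  apply: eq_bigr => z _; rewrite !hornerXsubC; congr `|_|.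
  have -> : (u - z) * (v - z) = u * v - (u + v) * z + z ^+ 2 by ring.
  by rewrite uDv uMv; ring.
rewrite -(ltr_nat C) natr_absz intr_norm normE.
apply: lt_le_trans (norm_prod_gt _ size_s root_s) _; first by rewrite ler1n.
by rewrite ler_peMl ?exprn_ege1 // prodr_ge0.
Qed.

(** * Irreducibility *)

Lemma prime_mul_factor_le p q x y :
  prime p -> (0 < q)%N -> (x * y = p * q)%N -> (x <= q)%N || (y <= q)%N.
Proof.
move=> p_pr q_gt0; wlog /dvdnP[k ->] : x y / (p %| x)%N => [IH xyE|].
  have: (p %| x * y)%N by rewrite xyE dvdn_mulr.
  rewrite Euclid_dvdM // => /orP[p_x|p_y]; first exact: IH.
  by rewrite orbC IH // mulnC.
rewrite [(k * p)%N]mulnC -mulnA => /eqP.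
rewrite eqn_pmul2l ?prime_gt0 // => /eqP kyE.
by rewrite [(y <= q)%N](@dvdn_leq) ?orbT // -kyE dvdn_mull.
Qed.

(** A rational factorization is rescaled to an integral one by Gauss's lemma; if
    both factors were nonconstant, their norms would both exceed [q], which the
    primality of [p] forbids. *)
Lemma irreducible_of_golden_norm (C : numClosedFieldType) (r : C) p q
    (f : {poly int}) :
  prime p -> (0 < q)%N -> 1 <= r -> r ^+ 2 - r - 1 = q%:R ->
  (1 < size f)%N -> `|golden_norm f|%N = (p * q)%N ->
  (forall z : C, root (map_poly intr f) z -> r < `|z|) ->
  irreducible_poly (map_poly intr f : {poly rat}).
Proof.
move=> p_pr q_gt0 r_ge1 rE size_f normf root_gt.
split=> [|g' + /dvdpP_rat_int[g [c c_neq0 gE]] [h fE]].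
  by rewrite size_rat_int_poly.
rewrite gE size_scale // size_rat_int_poly => size_g.
apply: (eqp_trans (eqp_scale _ c_neq0)); rewrite fE.
have f_neq0 : f != 0 by rewrite -size_poly_gt0 (ltn_trans _ size_f).
have g_neq0 : g != 0 by apply: contraNneq f_neq0; rewrite fE => ->; rewrite mul0r.
have h_neq0 : h != 0 by apply: contraNneq f_neq0; rewrite fE => ->; rewrite mulr0.
have [/eqP/size_poly1P[d d_neq0 ->]|size_h] := eqVneq (size h) 1%N.
  by rewrite mulrC mul_polyC map_polyZ /= eqp_sym eqp_scale // intr_eq0.
have norm_gt (k : {poly int}) : k != 0 -> size k != 1%N ->
    (forall z : C, root (map_poly intr k) z -> root (map_poly intr f) z) ->
    (q < `|golden_norm k|)%N.
  move=> k_neq0 size_k sub_root; apply: (golden_norm_gt r_ge1 rE q_gt0).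
    by rewrite ltn_neqAle eq_sym size_k size_poly_gt0.
  by move=> z /sub_root/root_gt.
have := @prime_mul_factor_le p q `|golden_norm g| `|golden_norm h| p_pr q_gt0.
rewrite -abszM -golden_normM -fE => /(_ normf).
by case/orP; rewrite leqNgt => /negP[]; apply: norm_gt => // z kz;
  rewrite fE rmorphM rootM kz ?orbT.
Qed.

Theorem theorem5p9 (R : realType) (n : nat) (a : nat -> int) (p q : nat) :
  (1 <= n)%N ->
  a n != 0 ->
  prime p ->
  (0 < q)%N ->
  `| \sum_(0 <= i < n.+1) (-1) ^+ i * a i ^+ 2
     + \sum_(0 <= i < n.+1) \sum_(i.+1 <= j < n.+1)
         (-1) ^+ i * (lucas (j - i))%:Z * a i * a j | = (p * q)%N%:Z ->
  \sum_(1 <= i < n.+1)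
     `|(a i)%:~R : R| * ((1 + Num.sqrt (4 * q%:R + 5)) / 2) ^+ i
    < `|(a 0%N)%:~R : R| ->
  irreducible_poly (\poly_(i < n.+1) (a i)%:~R : {poly rat}).
Proof.
move=> n_gt0 an_neq0 p_pr q_gt0 normf; set r := (_ / 2) => a0_gt.
pose f : {poly int} := \poly_(i < n.+1) a i.
have -> : \poly_(i < n.+1) (a i)%:~R = map_poly intr f :> {poly rat}.
  by apply/polyP => i; rewrite coef_map !coef_poly; case: ifP.
have size_f : size f = n.+1 by rewrite size_poly_eq.
have coef_f i : (i < n.+1)%N -> f`_i = a i by move=> lt_in; rewrite coef_poly lt_in.
have radicand_ge0 : 0 <= 4 * q%:R + 5 :> R by rewrite addr_ge0 ?mulr_ge0.
have r_ge1 : 1 <= r.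
  rewrite ler_pdivlMr // mul1r [leLHS](natrD _ 1 1) lerD2l.
  by rewrite -[leLHS]sqrtr1 ler_wsqrtr // ler_wpDl ?mulr_ge0 ?ler1n.
have rE : r ^+ 2 - r - 1 = q%:R.
  have -> : r ^+ 2 - r - 1 = (Num.sqrt (4 * q%:R + 5) ^+ 2 - 5) / 4.
    by rewrite /r; field.
  by rewrite sqr_sqrtr //; field.
clearbody r.
(* The complex numbers over [R]: the real inequality must be transported to a
   field over which [f] splits. *)
pose iota : {rmorphism R -> R[i]} := real_complex R.
have normC x : `|iota x| = iota `|x|.
  by rewrite normc_def /= expr0n addr0 sqrtr_sqr.
apply: (@irreducible_of_golden_norm _ (iota r) p q) => //.
- by rewrite -(rmorph1 iota) lecR.
- by rewrite -(rmorph_nat iota) -rE !rmorphB rmorphXn rmorph1.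
- by rewrite size_f.
- apply/eqP; rewrite -eqz_nat -normf abszE; apply/eqP; congr `|_|.
  rewrite /golden_norm size_f; congr (_ + _); apply: eq_big_nat => i /= lt_in.
    by rewrite coef_f.
  apply: eq_big_nat => j /andP[_ lt_jn].
  by rewrite !coef_f.
- move=> z /rootP fz0.
  apply: (@root_norm_gt _ n (fun i => (a i)%:~R)).
  + by rewrite -(rmorph0 iota) lecR (le_trans ler01).
  + rewrite -(rmorph_int iota) normC.
    suff -> : \sum_(1 <= i < n.+1) `|(a i)%:~R| * iota r ^+ i =
        iota (\sum_(1 <= i < n.+1) `|(a i)%:~R| * r ^+ i) by rewrite ltcR.
    rewrite rmorph_sum; apply: eq_bigr => i _.
    by rewrite rmorphM rmorphXn -normC rmorph_int.
  rewrite -[RHS]fz0 (@horner_coef_wide _ n.+1) ?big_mkord; last first.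
    by rewrite (leq_trans (size_poly _ _)) // size_f.
  by apply: eq_bigr => i _; rewrite coef_map /= coef_f.
Qed.
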